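(* Assume the following principle $( * )$: there is no tree $\pi$-base for $\omega^*$ of height $<\mathfrak c$, and every tree $\pi$-base for $\omega^*$ of height $\mathfrak c$ includes a cofinal branch. Then for every sequentially compact topological space $X$ with $|X|\le \mathfrak c$ there is $p\in\omega^*$ such that $X$ is $p$-compact.
   Context: $\mathfrak c=2^{\aleph_0}$; $\omega^*$ is the set of nonprincipal ultrafilters on $\omega$; $[\omega]^\omega$ is the set of infinite subsets of $\omega$; $A\subseteq^* B$ means that $A\setminus B$ is finite. A space is sequentially compact if every sequence in it has a convergent subsequence. For $p\in\omega^*$, a point $x\in X$ is a $p$-limit of a sequence $(x_n)_{n\in\omega}$ in $X$ if $\{n:x_n\in U\}\in p$ for every neighborhood $U$ of $x$; $X$ is $p$-compact if every sequence $\omega\to X$ has a $p$-limit in $X$. A tree $\pi$-base for $\omega^*$ is a family $T\subseteq[\omega]^\omega$ such that: (1) $T$ is a tree when ordered by $\subseteq^*$, growing downwards (i.e. $t$ lies above $s$ in the tree order iff $t\subseteq^* s$, and the set of members of $T$ strictly below a given node in the tree order is well ordered); (2) each level of $T$ is an infinite maximal almost disjoint family in $[\omega]^\omega$; (3) for every $A\in[\omega]^\omega$ there is $t\in T$ with $t\subseteq^* A$. The height of $T$ is the least ordinal $\alpha$ such that the $\alpha$-th level of $T$ is empty. A cofinal branch is a maximal chain of $T$ meeting every level of $T$ below its height. *)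

(* Defs.v *)
From mathcomp Require Import all_boot.
From mathcomp Require Import all_classical topology.
Set Implicit Arguments.
Unset Strict Implicit.
Unset Printing Implicit Defensive.

Local Open Scope classical_set_scope.
Local Open Scope card_scope.

(** Ordinals are represented by (reflexive) well-orders on arbitrary types and
    are only ever compared up to order isomorphism. *)

Record ord := Ord {
  ord_sort :> Type;
  ole : rel ord_sort;
  ole_well_order : wochoice.well_order ole }.

Definition order_iso (a : ord) (U : Type) (r : rel U) (A : set U) : Prop :=
  exists f : a -> U,
    set_bij [set: a] A f /\ {mono f : x y / ole x y >-> r x y}.

Definition ord_lt (a b : ord) : Prop :=
  exists y : b, order_iso a (@ole b) [set x | ole x y /\ x <> y].

(** [k] is the initial ordinal of cardinality [2 ^ aleph_0]. *)
Definition is_continuum (k : ord) : Prop :=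
  [set: k] #= [set: set nat] /\
  forall a : ord, ord_lt a k -> ~ ([set: a] #= [set: set nat]).

Definition inf_subsets : set (set nat) := [set A | infinite_set A].

Definition almost_subset : rel (set nat) :=
  fun A B => `[< finite_set (A `\` B) >].

(** The tree order grows downwards. *)
Definition tree_le : rel (set nat) := fun s t => almost_subset t s.

Definition predecessors (T : set (set nat)) (t : set nat) : set (set nat) :=
  [set s | [/\ T s, tree_le s t & s <> t]].

(** [almost_subset] is only a preorder on [set nat]; antisymmetry says that
    [T] has no two distinct members which are equal modulo finite. *)
Definition is_tree (T : set (set nat)) : Prop :=
  (forall s t, T s -> T t -> tree_le s t -> tree_le t s -> s = t) /\
  (forall t, T t -> wochoice.wo_chain tree_le (mem (predecessors T t))).

Definition level (T : set (set nat)) (a : ord) : set (set nat) :=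
  [set t | T t /\ order_iso a tree_le (predecessors T t)].

Definition is_height (T : set (set nat)) (a : ord) : Prop :=
  level T a = set0 /\ forall b : ord, ord_lt b a -> level T b !=set0.

Definition almost_disjoint_family (M : set (set nat)) : Prop :=
  M `<=` inf_subsets /\
  forall A B, M A -> M B -> A <> B -> finite_set (A `&` B).

Definition mad_family (M : set (set nat)) : Prop :=
  almost_disjoint_family M /\
  forall N, almost_disjoint_family N -> M `<=` N -> N = M.

(** The levels of [T] are the nonempty sets [level T a]. *)
Definition tree_pi_base (T : set (set nat)) : Prop :=
  [/\ T `<=` inf_subsets,
      is_tree T,
      forall a : ord, level T a !=set0 ->
        infinite_set (level T a) /\ mad_family (level T a) &
      forall A, inf_subsets A -> exists2 t, T t & almost_subset t A].

Definition tree_chain (T B : set (set nat)) : Prop :=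
  B `<=` T /\ total_on B tree_le.

Definition cofinal_branch (T B : set (set nat)) : Prop :=
  [/\ tree_chain T B,
      forall C, tree_chain T C -> B `<=` C -> C = B &
      forall h a : ord, is_height T h -> ord_lt a h -> B `&` level T a !=set0].

Definition principle_star : Prop :=
  forall c : ord, is_continuum c ->
    (forall (T : set (set nat)) (h : ord),
       tree_pi_base T -> is_height T h -> ~ ord_lt h c) /\
    (forall T : set (set nat), tree_pi_base T -> is_height T c ->
       exists B, cofinal_branch T B).

Definition nonprincipal_ultrafilters : set (set_system nat) :=
  [set p | UltraFilter p /\ ~ exists n, p = principal_filter n].

Definition sequentially_compact (X : topologicalType) : Prop :=
  forall u : nat -> X, exists k : nat -> nat,
    {homo k : m n / (m < n)%N} /\ exists x : X, (u \o k) @ \oo --> x.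

Definition p_limit (p : set_system nat) (X : topologicalType)
    (u : nat -> X) (x : X) : Prop := u @ p --> x.

Definition p_compact (p : set_system nat) (X : topologicalType) : Prop :=
  forall u : nat -> X, exists x : X, p_limit p u x.

(* Main.v *)
Require Import Defs.
From mathcomp Require Import all_boot.
From mathcomp Require Import all_classical topology.

Local Open Scope classical_set_scope.
Local Open Scope card_scope.

Set Implicit Arguments.
Unset Strict Implicit.
Unset Printing Implicit Defensive.

(** The infinite subsets of [nat], ordered by almost inclusion, are treated as a
    forcing notion. For a sequence [u] in a sequentially compact space, the infinite
    sets along which [u] converges form an open dense family, and a space with at
    most continuum many points has at most continuum many sequences. One looks for
    a chain of infinite sets meeting all these families: an ultrafilter containing
    the chain then gives every sequence a limit. The principle supplies such a
    chain as a cofinal branch, provided that the families can be threaded through the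
    levels of a tree pi-base of height exactly the continuum.

    The tool is the base tree theorem of Balcar, Pelant and Simon ([base_tree]). Let
    [k] be a well-order such that fewer than [k] open dense families always have
    dense intersection, and let [D x], for [x] in [k], be open dense families without
    common member. Choosing by recursion maximal almost disjoint families, level [x]
    inside [D x] and strictly refining all earlier levels, one gets a tree of height
    [k] ([tower_exists], [tower_is_tree], [tower_height]). For it to have a member
    below every infinite [A], one first shows that on some level continuum many
    members have infinite trace on [A] ([tower_wide]); this uses that [k] has
    uncountable cofinality ([countable_bounded]), a consequence of the countable
    case of distributivity. There are only continuum many [A], so each of them can
    reserve a member of such a level for itself ([wide_representatives]), and the
    following levels, which must decide [A] below the reserved member, contain a
    member below [A].

    The theorem is applied twice. If the continuum failed to be distributive, the
    least failure would give a tree pi-base of smaller height, contrary to the first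
    half of the principle ([continuum_distributive]). Being distributive, the
    continuum carries a base tree on which level [x] decides the subset of [nat]
    coded by [x], so that no infinite set lies in all the families, and makes the
    sequence coded by [x] converge. *)

(** * Almost inclusion *)

Notation "A `<=*` B" := (finite_set (A `\` B)) (at level 70).

Lemma asubP A B : almost_subset A B <-> A `<=*` B.
Proof. by rewrite /almost_subset asboolE. Qed.

Lemma subset_asub (A B : set nat) : A `<=` B -> A `<=*` B.
Proof. by move=> AB; rewrite (_ : _ `\` _ = set0)// setD_eq0. Qed.

Lemma asub_refl (A : set nat) : A `<=*` A.
Proof. exact: subset_asub. Qed.

Lemma asub_trans (B A C : set nat) : A `<=*` B -> B `<=*` C -> A `<=*` C.
Proof.
move=> AB BC; apply: (@sub_finite_set _ _ ((A `\` B) `|` (B `\` C))).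
  by move=> x [Ax Cx]; have [Bx|Bx] := pselect (B x); [right|left].
by rewrite finite_setU.
Qed.

Lemma asub_infinite (A B : set nat) :
  infinite_set A -> A `<=*` B -> infinite_set B.
Proof.
move=> iA AB fB; apply: iA; apply: (@sub_finite_set _ _ ((A `\` B) `|` B)).
  by move=> x Ax; have [Bx|Bx] := pselect (B x); [right|left].
by rewrite finite_setU.
Qed.

Lemma meet_asub (A A' B B' : set nat) :
  infinite_set (A `&` B) -> A `<=*` A' -> B `<=*` B' ->
  infinite_set (A' `&` B').
Proof.
move=> iAB AA BB; apply: asub_infinite iAB _.
apply: (@sub_finite_set _ _ ((A `\` A') `|` (B `\` B'))).
  move=> x [[Ax Bx]] /not_andP[nx|nx]; [left|right]; by split.
by rewrite finite_setU.
Qed.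

Definition embeds (T U : Type) (B : set U) :=
  exists2 f : T -> U, injective f & forall t, B (f t).

Lemma card_leT_embeds (T U : Type) (B : set U) : [set: T] #<= B <-> embeds T B.
Proof.
split=> [/card_leP[f]|[f fI Bf]].
  exists (fun x => val (f (exist _ x (mem_set I)))).
    move=> x y /val_inj h.
    suff [] : exist _ x (mem_set I) = exist _ y (mem_set I) :> [set: T] by [].
    by apply: (@inj _ _ _ f) => //; rewrite inE.
  by move=> x; apply: set_mem; apply: valP.
apply: (@card_le_trans _ _ _ (range f)); last first.
  by apply: subset_card_le => _ [x _ <-].
suff /card_eqPle[] : range f #= [set: T] by [].
by apply: inj_card_eq => x y _ _; exact: fI.
Qed.

Lemma infinite_embeds (T : Type) (A : set T) :
  infinite_set A <-> embeds nat A.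
Proof. by rewrite infiniteP; exact: card_leT_embeds. Qed.

Lemma infinite_image (f : nat -> nat) (A : set nat) :
  injective f -> infinite_set A -> infinite_set (f @` A).
Proof.
move=> fI /infinite_embeds[g gI Ag]; apply/infinite_embeds.
by exists (f \o g); [exact: inj_comp|move=> n; exists (g n)].
Qed.

Lemma infinite_halve (A : set nat) : infinite_set A ->
  exists B, [/\ B `<=` A, infinite_set B & infinite_set (A `\` B)].
Proof.
move=> /infinite_embeds[f fI Af].
exists (range (f \o double)); split=> [_ [n _ <-]||].
- exact: Af.
- apply/infinite_embeds; exists (f \o double) => [m n /fI/double_inj//|n].
  by exists n.
- apply/infinite_embeds; exists (fun n => f n.*2.+1).
  by move=> m n /fI [/double_inj].
by move=> n; split=> // -[m _ /fI /(congr1 odd)]; rewrite /= !odd_double.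
Qed.

Lemma unbounded_infinite (f : nat -> nat) :
  (forall n, n <= f n) -> infinite_set (range f).
Proof.
move=> fn /finite_seqP[s sE]; pose m := \max_(i <- s) i.
have fm : f m.+1 \in s by have : range f (f m.+1) by []; rewrite sE.
suff : f m.+1 <= m by move=> /(leq_trans (fn _)); rewrite ltnn.
exact: leq_bigmax_seq fm isT.
Qed.

Lemma infinite_above (A : set nat) n : infinite_set A ->
  exists2 m, A m & n <= m.
Proof.
move=> iA; apply: contrapT => h; apply: iA.
apply: (sub_finite_set _ (finite_II n)) => m Am /=.
by rewrite ltnNge; apply/negP => nm; apply: h; exists m.
Qed.

(** Any choice of points [f n >= n] in [P n] works: all but finitely many of them
    lie in a given [P n] because the sequence decreases. *)
Lemma pseudo_intersection (P : nat -> set nat) :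
  (forall n, infinite_set (P n)) -> (forall n, P n.+1 `<=` P n) ->
  exists2 s, infinite_set s & forall n, s `<=*` P n.
Proof.
move=> iP sP.
have mono m n : m <= n -> P n `<=` P m.
  elim: n => [|n IH]; first by rewrite leqn0 => /eqP->.
  rewrite leq_eqVlt => /orP[/eqP->//|]; rewrite ltnS => /IH h.
  exact: subset_trans (sP n) h.
have /choice[f fP] n : exists m, P n m /\ n <= m.
  by have [m] := infinite_above n (iP n); exists m.
exists (range f); first by apply: unbounded_infinite => n; case: (fP n).
move=> n; apply: (@sub_finite_set _ _ (f @` `I_n)); last exact: finite_image.
move=> _ [[m _ <-]] nP; exists m => //=; rewrite ltnNge; apply/negP => nm.
by apply: nP; apply: mono nm _ _; case: (fP m).
Qed.

(** * Open dense families and maximal almost disjoint families *)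

(** Open and dense in the forcing order of infinite sets under almost inclusion.
    Density asks for genuine inclusion, which openness makes harmless. *)
Definition open_dense (D : set (set nat)) :=
  (forall s t, D s -> infinite_set t -> t `<=*` s -> D t) /\
  (forall A, infinite_set A -> exists s, [/\ s `<=` A, infinite_set s & D s]).

Lemma open_denseI D E : open_dense D -> open_dense E -> open_dense (D `&` E).
Proof.
move=> [Do Dd] [Eo Ed]; split=> [s t [Ds Es] it ts|A iA].
  by split; [exact: Do ts|exact: Eo ts].
have [s [sA iS Ds]] := Dd A iA; have [t [ts it Et]] := Ed s iS.
exists t; split=> //; first exact: subset_trans sA.
by split=> //; apply: Do it _; [exact: Ds|exact: subset_asub].
Qed.

(** Descend through the families one after the other and take a
    pseudo-intersection, which openness keeps in every one of them. *)
Lemma countable_dense (D : nat -> set (set nat)) :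
  (forall n, open_dense (D n)) ->
  forall A, infinite_set A ->
  exists s, [/\ s `<=` A, infinite_set s & forall n, D n s].
Proof.
move=> oD A iA.
have /choice[g gP] (nB : nat * set nat) : exists s, infinite_set nB.2 ->
    [/\ s `<=` nB.2, infinite_set s & D nB.1 s].
  have [iB|nB2] := pselect (infinite_set nB.2); last by exists set0.
  by have [s sP] := (oD nB.1).2 _ iB; exists s.
pose P := fix P n := if n is m.+1 then g (m, P m) else A.
have iP n : infinite_set (P n).
  by elim: n => [//|n IH] /=; case: (gP (n, P n) IH).
have sP n : P n.+1 `<=` P n by case: (gP (n, P n) (iP n)).
have [s iS sPn] := pseudo_intersection iP sP.
exists (s `&` A); have iSA : infinite_set (s `&` A).
  rewrite -[s]setIid in iS.
  by apply: meet_asub iS (asub_refl s) (sPn 0).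
split=> // n; have [_ _ Dn] := gP (n, P n) (iP n).
apply: (oD n).1 Dn iSA _; apply: asub_trans (sPn n.+1).
by apply: subset_asub => x [].
Qed.

(** Maximality is put in the form in which it is used: every infinite set has
    infinite trace on some member. *)
Definition mad (M : set (set nat)) :=
  [/\ M `<=` inf_subsets,
      forall s t, M s -> M t -> infinite_set (s `&` t) -> s = t &
      forall A, infinite_set A -> exists2 t, M t & infinite_set (A `&` t)].

Lemma mad_mad_family M : mad M -> mad_family M.
Proof.
move=> [iM aM mM]; split.
  split=> // s t Ms Mt st; apply: contrapT => h; apply: st; exact: aM.
move=> N [iN aN] MN; apply/seteqP; split=> // A NA.
have [t Mt iAt] := mM A (iN _ NA).
have [->//|At] := pselect (A = t).
by case: iAt; apply: aN => //; exact: MN.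
Qed.

Lemma mad_asub M s t t' : mad M -> M t -> M t' -> infinite_set s ->
  s `<=*` t -> s `<=*` t' -> t = t'.
Proof.
move=> [_ aM _] Mt Mt' iS st st'; apply: aM => //.
by rewrite -[s]setIid in iS; exact: meet_asub iS st st'.
Qed.

(** A family maximal among the almost disjoint subfamilies of [E] is already
    maximal among all of them: a witness to the contrary could be shrunk into [E]. *)
Lemma mad_exists (E : set (set nat)) :
  (forall A, infinite_set A -> exists s, [/\ s `<=` A, infinite_set s & E s]) ->
  exists M, mad M /\ M `<=` E.
Proof.
move=> dE.
pose P (M : set (set nat)) := (M `<=` inf_subsets `&` E) /\
  forall s t, M s -> M t -> infinite_set (s `&` t) -> s = t.
have [|M [[ME aM] maxM]] := @Zorn_bigcup _ P.
  move=> F FP tF; split=> [s [M FM Ms]|s t [M FM Ms] [N FN Nt]].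
    exact: (FP _ FM).1.
  case: (tF _ _ FM FN) => h.
    by apply: (FP _ FN).2 => //; exact: h.
  by apply: (FP _ FM).2 => //; exact: h.
exists M; split; last by move=> s /ME[].
split=> [s /ME[]//|//|A iA].
have [s [sA iS Es]] := dE A iA; apply: contrapT => h.
have nMs : ~ M s.
  by move=> Ms; apply: h; exists s => //; rewrite (setIidr sA).
have disj t : M t -> ~ infinite_set (s `&` t).
  move=> Mt ist; apply: h; exists t => //.
  by apply: sub_infinite_set ist; exact: setSI.
apply: (maxM (M `|` [set s])).
  split; first by move=> t Mt; left.
  by move=> /(_ s) h'; apply: nMs; apply: h'; right.
split=> [t [/ME//|->//]|t t' [Mt|->] [Mt'|->]] //.
- exact: aM.
- by rewrite setIC => /disj h'; exact: False_ind (h' Mt).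
- by move=> /disj h'; exact: False_ind (h' Mt').
Qed.

(** * Well-orders and transfinite choice *)

Definition olt (k : ord) (x y : k) : Prop := ole x y /\ x <> y.

Section WellOrder.
Variable k : ord.
Implicit Types x y z : k.

Lemma ole_min_unique (P : k -> Prop) : (exists x, P x) ->
  exists! x, P x /\ forall y, P y -> ole x y.
Proof.
move=> [x Px].
have [|m [[Pm lm] mU]] := @ole_well_order k [pred w | `[< P w >]].
  by exists x; apply/asboolP.
exists m; split.
  by split=> [|y Py]; [exact/asboolP|apply: lm; exact/asboolP].
move=> y [Py ly]; apply: mU; split; first exact/asboolP.
by move=> z /asboolP; exact: ly.
Qed.

Lemma ole_min (P : k -> Prop) : (exists x, P x) ->
  exists x, P x /\ forall y, P y -> ole x y.
Proof. by move=> /ole_min_unique[x [? _]]; exists x. Qed.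

Lemma ole_refl x : ole x x.
Proof. by have [|v [-> h]] := @ole_min (eq^~ x); [exists x|exact: h]. Qed.

Lemma ole_anti x y : ole x y -> ole y x -> x = y.
Proof.
move=> xy yx; have [|m [_ mU]] := @ole_min_unique (fun w => w = x \/ w = y).
  by exists x; left.
have mx : m = x.
  by apply: mU; split=> [|v [] ->//]; [left|exact: ole_refl].
rewrite -mx; apply: mU; split=> [|v [] ->//]; [by right|exact: ole_refl].
Qed.

Lemma ole_total x y : ole x y \/ ole y x.
Proof.
have [|v [[]-> h]] := @ole_min (fun w => w = x \/ w = y).
- by exists x; left.
- by left; apply: h; right.
- by right; apply: h; left.
Qed.

Lemma ole_trans x y z : ole x y -> ole y z -> ole x z.
Proof.
move=> xy yz; have [|v [vE h]] := @ole_min (fun w => [\/ w = x, w = y | w = z]).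
  by exists x; constructor 1.
case: vE h => -> h.
- by apply: h; constructor 3.
- by rewrite (ole_anti xy (h x _))//; constructor 1.
- by rewrite -(ole_anti yz (h y _))//; constructor 2.
Qed.

Lemma olt_total x y : [\/ olt x y, x = y | olt y x].
Proof.
have [->|xy] := pselect (x = y); first by constructor 2.
by case: (ole_total x y) => h; [constructor 1|constructor 3]; split=> // /esym.
Qed.

Lemma olt_le_trans x y z : olt x y -> ole y z -> olt x z.
Proof.
move=> [xy nxy] yz; split; first exact: ole_trans yz.
by move=> xz; apply: nxy; apply: ole_anti => //; rewrite xz.
Qed.

Lemma olt_trans x y z : olt x y -> olt y z -> olt x z.
Proof. by move=> xy [yz _]; exact: olt_le_trans yz. Qed.

Lemma oltNle x y : ~ ole x y -> olt y x.
Proof.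
by case: (olt_total x y) => [[]|->|] // []; exact: ole_refl.
Qed.

Lemma olt_leN x y : olt x y -> ~ ole y x.
Proof. by move=> [xy nxy] yx; apply: nxy; exact: ole_anti. Qed.

Lemma olt_ind (P : k -> Prop) :
  (forall x, (forall y, olt y x -> P y) -> P x) -> forall x, P x.
Proof.
move=> IH x; apply: contrapT => nPx.
have [|m [nPm mP]] := @ole_min (fun w => ~ P w); first by exists x.
apply: nPm; apply: IH => y ym; apply: contrapT => /mP.
exact: olt_leN.
Qed.

(** Dependent choice along a well-order. It serves twice: to pick distinct
    representatives and to build the levels of a tower. *)
Lemma transfinite_choice (T : Type) (R : k -> (k -> T) -> T -> Prop) :
  (forall x f g t, (forall y, olt y x -> f y = g y) -> R x f t -> R x g t) ->
  (forall x f, (forall y, olt y x -> R y f (f y)) -> exists t, R x f t) ->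
  inhabited T -> exists f, forall x, R x f (f x).
Proof.
move=> locR stepR [t0].
have wf : well_founded (@olt k).
  by move=> x; apply: olt_ind => y h; constructor.
have /choice[F FP] (xf : k * (k -> T)) :
    exists t, (exists t, R xf.1 xf.2 t) -> R xf.1 xf.2 t.
  by have [[t Rt]|n] := pselect (exists t, R xf.1 xf.2 t); [exists t|exists t0].
(* The recursion only provides values below x; [ext] makes them total. *)
pose ext x (g : forall y, olt y x -> T) y :=
  if pselect (olt y x) is left h then g y h else t0.
pose step x g := F (x, ext x g).
pose f := Fix wf (fun _ => T) step.
have fE x : f x = F (x, ext x (fun y _ => f y)).
  rewrite /f Fix_eq//= => {}x g h gh; congr F; congr pair.
  by apply/funext => y; rewrite /ext; case: pselect.
exists f; apply: olt_ind => x IH.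
have extE y : olt y x -> f y = ext x (fun y _ => f y) y.
  by rewrite /ext; case: pselect.
have [t Rt] := stepR x f IH.
rewrite fE; apply: (locR _ (ext x (fun y _ => f y))).
  by move=> y /extE.
by apply: (FP (x, _)); exists t; exact: locR Rt.
Qed.

End WellOrder.

(** The least [x] with [f x < x] would give [f (f x) < f x], a smaller one. *)
Lemma increasing_expansive (k : ord) (f : k -> k) (P : k -> Prop) :
  (forall x y, P x -> P y -> olt x y -> olt (f x) (f y)) ->
  (forall x y, P x -> olt y x -> P y) ->
  forall x, P x -> ole x (f x).
Proof.
move=> fI Pdown x Px; apply: contrapT => /(@oltNle k) h.
have [|m [[Pm mf] mmin]] := @ole_min k (fun x => P x /\ olt (f x) x).
  by exists x.
have Pf : P (f m) by exact: Pdown mf.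
by apply: (olt_leN mf); apply: mmin; split => //; exact: fI.
Qed.

Definition segment (k : ord) (x : k) : set k := [set y | olt y x].

Lemma order_iso_trans (a : ord) (V U : Type) (q : rel V) (r : rel U)
    (A : set V) (B : set U) (f : V -> U) :
  order_iso a q A -> set_bij A B f ->
  (forall x y, A x -> A y -> r (f x) (f y) = q x y) -> order_iso a r B.
Proof.
move=> [g [gB gm]] fB fm; exists (f \o g); split; first exact: set_bij_comp fB.
by move=> x y /=; rewrite fm ?gm //; case: gB => + _ _; exact.
Qed.

(** Composing the two isomorphisms would map the longer segment increasingly into
    the shorter one, hence move its elements down. *)
Lemma segment_iso_unique (a k : ord) (x y : k) :
  order_iso a (@ole k) (segment x) -> order_iso a (@ole k) (segment y) -> x = y.
Proof.
wlog xy : x y / olt x y.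
  move=> wl hx hy; case: (olt_total x y) => // h; first exact: wl.
  by apply/esym; exact: wl.
move=> [f [[fS _ _] fm]] [g [[_ _ gJ] gm]]; exfalso.
have /choice[h hP] z : exists w, olt z y -> g w = z.
  have [zy|n] := pselect (olt z y); last by have [w _ _] := gJ x xy; exists w.
  by have [w _ <-] := gJ z zy; exists w.
have hx z : olt z y -> olt (f (h z)) x by move=> _; apply: fS.
apply: (olt_leN (hx x xy)).
apply: (@increasing_expansive k (f \o h) (segment y)) => //.
  move=> u v /= uy vy [uv nuv]; split.
    by rewrite fm -gm !hP.
  move=> /= fuv; apply: nuv; rewrite -(hP u)// -(hP v)//.
  by apply: ole_anti; rewrite gm -fm fuv ole_refl.
by move=> u v /= uy vu; apply: olt_trans vu uy.
Qed.

(** * The initial ordinal of the continuum *)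

Definition segment_le (k : ord) (x : k) : rel {y : k | olt y x} :=
  fun u v => ole (sval u) (sval v).

Lemma segment_val_inj (k : ord) (x : k) :
  injective (sval : {y : k | olt y x} -> k).
Proof.
by move=> u v; apply: eq_sig_hprop => ? ? ?; exact: Prop_irrelevance.
Qed.

Lemma segment_well_order (k : ord) (x : k) :
  wochoice.well_order (@segment_le k x).
Proof.
apply: wochoice.antisymmetric_well_order.
  move=> u v /andP[uv vu]; apply: segment_val_inj; exact: ole_anti.
move=> A [[y yx] Ay].
have [|m [[mx Am] mmin]] := @ole_min k
  (fun y => exists h : olt y x, exist (fun y => olt y x) y h \in A).
  by exists y, yx.
exists (exist _ m mx); split=> // -[v vx] Av.
by apply: mmin; exists vx.
Qed.

Definition segment_ord (k : ord) (x : k) : ord := Ord (@segment_well_order k x).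

Lemma segment_ord_iso (k : ord) (x : k) :
  order_iso (segment_ord x) (@ole k) (segment x).
Proof.
exists sval; split=> //; split=> [[v vx] _ //|u v _ _|y yx].
  exact: segment_val_inj.
by exists (exist _ y yx).
Qed.

Lemma segment_ord_lt (k : ord) (x : k) : ord_lt (segment_ord x) k.
Proof. exists x; exact: segment_ord_iso. Qed.

(** The order type of the continuum, with the cardinal conditions stated as
    embeddings, the form in which choices below a point are counted. *)
Definition initial_continuum (k : ord) :=
  [/\ embeds (set nat) [set: k], embeds k [set: set nat] &
      forall x : k, ~ embeds (set nat) (segment x)].

Lemma initial_continuum_exists : exists k, initial_continuum k.
Proof.
have [R wR] := wochoice.well_ordering_principle (set nat).
pose k := Ord wR.
have [kx|n] := pselect (exists x : k, embeds (set nat) (segment x)); last first.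
  exists k; split; [by exists id|by exists id|].
  by move=> y h; apply: n; exists y.
have [|m [[f fI fm] mmin]] := @ole_min k (fun x => embeds (set nat) (segment x)).
  exact: kx.
exists (segment_ord m); split.
- exists (fun A => exist _ (f A) (fm A) : segment_ord m) => //.
  by move=> A B [/fI].
- by exists sval => //; exact: segment_val_inj.
- move=> [x xm] [g gI gx]; apply: (olt_leN xm); apply: mmin.
  exists (sval \o g).
    move=> A B /= gAB; apply: gI; exact: segment_val_inj.
  move=> A; have [gx1 gx2] := gx A; split=> // gE; apply: gx2.
  exact: segment_val_inj.
Qed.

Lemma initial_continuum_is_continuum k : initial_continuum k -> is_continuum k.
Proof.
move=> [ck kc small]; split.
  by apply/card_eqPle; split; apply/card_leT_embeds.
move=> a [y [f [[fS fI _] fm]]] /card_eqPle[_ /card_leT_embeds[g gI _]].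
apply: (small y); exists (f \o g); last by move=> A; exact: fS.
by move=> A B /fI h; apply: gI; apply: h; rewrite inE.
Qed.

(** * Towers of refining families *)

(** The sets [A] below which [M] has room for a member of its own: continuum
    many members of [M] have infinite trace on [A]. *)
Definition wide (M : set (set nat)) (A : set nat) :=
  embeds (set nat) [set t | M t /\ infinite_set (A `&` t)].

(** Distinct representatives can be chosen by recursion along the continuum,
    because fewer than continuum many members of [M] are taken at any stage. *)
Lemma wide_representatives k (M : set (set nat)) : initial_continuum k ->
  exists phi : set nat -> set nat,
    (forall A, wide M A -> M (phi A) /\ infinite_set (A `&` phi A)) /\
    (forall A B, wide M A -> wide M B -> phi A = phi B -> A = B).
Proof.
move=> [[e eI _] _ small].
pose R (x : k) (f : k -> set nat) (t : set nat) :=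
  forall A, e A = x -> wide M A ->
  [/\ M t, infinite_set (A `&` t) & forall y, olt y x -> f y <> t].
have [|x f _||f fP] := @transfinite_choice k (set nat) R.
- move=> x f g t fg Rt A Ax wA; have [Mt At ft] := Rt A Ax wA.
  by split=> // y yx; rewrite -fg //; exact: ft.
- have [[A [Ax wA]]|n] := pselect (exists A, e A = x /\ wide M A); last first.
    by exists set0 => A Ax wA; exfalso; apply: n; exists A.
  apply: contrapT => h; have [g gI gP] := wA.
  (* If every candidate were taken, sending it to the stage that took it
     would embed the continuum below x. *)
  have /choice[b bP] C : exists y, olt y x /\ f y = g C.
    apply: contrapT => n; apply: h; exists (g C) => B Bx _.
    have -> : B = A by apply: eI; rewrite Bx.
    by have [? ?] := gP C; split=> // y yx fy; apply: n; exists y.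
  apply: (small x); exists b; last by move=> C; case: (bP C).
  by move=> C C' bC; apply: gI; rewrite -(bP C).2 -(bP C').2 bC.
- exact: (inhabits set0).
exists (f \o e); split=> [A wA|A B wA wB /= fAB].
  by have [] := fP (e A) A erefl wA.
apply: eI; case: (olt_total (e A) (e B)) => // h.
  by have [_ _ /(_ _ h)] := fP (e B) B erefl wB.
by have [_ _ n] := fP (e A) A erefl wA; case: (n _ h).
Qed.

(** The columns of [nat * nat] split [nat] into infinitely many infinite pieces;
    deciding in which column one lies is what forces levels to be infinite. *)
Definition column (n : nat) : set nat := range (fun m : nat => pickle (n, m)).

Lemma column_inj m n x : column m x -> column n x -> m = n.
Proof.
by move=> [i _ <-] [j _ /(pcan_inj pickleK)[->]].
Qed.

Lemma infinite_column n : infinite_set (column n).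
Proof.
apply/infinite_embeds; exists (fun m => pickle (n, m)); last by move=> m; exists m.
by move=> i j /(pcan_inj pickleK)[].
Qed.

Definition column_decided : set (set nat) :=
  [set s | (exists n, s `<=*` column n) \/
           (forall n, finite_set (s `&` column n))].

Lemma finite_meet_asub (s t A : set nat) :
  t `<=*` s -> finite_set (s `&` A) -> finite_set (t `&` A).
Proof.
move=> ts sA; apply: contrapT => tA; apply: (meet_asub tA ts (asub_refl A)).
exact: sA.
Qed.

Lemma open_dense_column_decided : open_dense column_decided.
Proof.
split=> [s t [[n sn]|sn] it ts|A iA].
- by left; exists n; exact: asub_trans sn.
- by right=> n; exact: finite_meet_asub (sn n).
have [[n iAn]|nA] := pselect (exists n, infinite_set (A `&` column n)).
  exists (A `&` column n); split=> //; left; exists n.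
  by apply: subset_asub => x [].
exists A; split=> //; right=> n; apply: contrapT => h; apply: nA.
by exists n.
Qed.

(** Maximality gives each column a member with infinite trace on it, which must
    then lie in that column; the columns being disjoint, these members differ. *)
Lemma mad_infinite M : mad M -> M `<=` column_decided -> infinite_set M.
Proof.
move=> [iM _ mM] dM; apply/infinite_embeds.
have /choice[t tP] n : exists t, M t /\ t `<=*` column n.
  have [t Mt nt] := mM _ (@infinite_column n).
  exists t; split=> //; have [[m tm]|tn] := dM t Mt; last first.
    by case: nt; rewrite setIC; exact: tn.
  suff -> : n = m by [].
  have := meet_asub nt (asub_refl _) tm.
  by move=> /infinite_setN0[x [xn xm]]; exact: column_inj xn xm.
exists t => [m n tmn|n]; last by case: (tP n).
have [Mt tm] := tP m; have [_] := tP n; rewrite -tmn => tn.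
have iT : infinite_set (t m `&` t m) by rewrite setIid; exact: iM.
by have /infinite_setN0[x [xm xn]] := meet_asub iT tm tn; exact: column_inj xm xn.
Qed.

Section Refinement.
Variable phi : set nat -> set nat.
Variable M : set (set nat).

(** What a set has to satisfy to lie on a level below [M]. It must be strictly
    below some [t] in [M], so that the tree order separates levels; and if [t] is
    the member reserved for [A], it must decide [A], so that a later maximal
    family has a member below [A]. *)
Definition refinement : set (set nat) :=
  [set s | exists t, [/\ M t, s `<=*` t, infinite_set (t `\` s) &
     forall A, wide M A -> t = phi A -> s `<=*` A \/ finite_set (s `&` A)]].

Lemma open_dense_refinement : mad M ->
  (forall A B, wide M A -> wide M B -> phi A = phi B -> A = B) ->
  open_dense refinement.
Proof.
move=> [iM aM mM] phiI; split=> [s s' [t [Mt st ts tA]] is' s's|S iS].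
  exists t; split=> //; first exact: asub_trans st.
    apply: asub_infinite ts _; apply: sub_finite_set s's.
    move=> x [[tx sx] tsx]; split=> //; apply: contrapT => s'x.
    by apply: tsx.
  move=> A wA /(tA A wA)[sA|sA]; [left; exact: asub_trans sA|right].
  exact: finite_meet_asub sA.
have [t Mt iSt] := mM S iS.
suff [u [uS iu uA]] : exists u, [/\ u `<=` S `&` t, infinite_set u &
    forall A, wide M A -> t = phi A -> u `<=*` A \/ finite_set (u `&` A)].
  (* Halving u is what makes t minus the result infinite. *)
  have [v [vu iv iuv]] := infinite_halve iu.
  exists v; split=> //; first by move=> x /vu/uS[].
  exists t; split=> //.
  - by apply: subset_asub => x /vu/uS[].
  - by apply: sub_infinite_set iuv => x [/uS[]].
  - move=> A wA /(uA A wA)[h|h]; [left|right].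
      by apply: asub_trans h; exact: subset_asub.
    by apply: finite_meet_asub h; exact: subset_asub.
have [[A [wA tA]]|nA] := pselect (exists A, wide M A /\ t = phi A); last first.
  by exists (S `&` t); split=> // A wA tA; exfalso; apply: nA; exists A.
have phiA B : wide M B -> t = phi B -> B = A.
  by move=> wB tB; apply: phiI => //; rewrite -tB.
(* Only one A can have t as its representative, so one decision suffices. *)
have [iA|fA] := pselect (infinite_set (S `&` t `&` A)).
  exists (S `&` t `&` A); split=> // B wB /(phiA B wB)->.
  by left; apply: subset_asub => x [].
exists (S `&` t); split=> // B wB /(phiA B wB)->; right.
exact: contrapT.
Qed.

End Refinement.

(** In other words, [k] is at most the distributivity number of the forcing order.
    The families are indexed by an initial segment, which is how a recursion
    along [k] meets them. *)
Definition distributive (k : ord) := forall (x : k) (D : k -> set (set nat)),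
  (forall y, olt y x -> open_dense (D y)) ->
  forall A, infinite_set A ->
  exists s, [/\ s `<=` A, infinite_set s & forall y, olt y x -> D y s].

Definition tower (k : ord) (D : k -> set (set nat))
    (Phi : set (set nat) -> set nat -> set nat) (T : k -> set (set nat)) :=
  forall x, [/\ mad (T x), T x `<=` D x, T x `<=` column_decided &
    forall y, olt y x -> T x `<=` refinement (Phi (T y)) (T y)].

(** The requirements on level [x] define a dense family: distributivity
    handles those coming from the earlier levels. *)
Lemma tower_exists k D Phi : distributive k ->
  (forall x : k, open_dense (D x)) ->
  (forall M A B, wide M A -> wide M B -> Phi M A = Phi M B -> A = B) ->
  exists T, tower D Phi T.
Proof.
move=> dk oD PhiI.
apply: (@transfinite_choice k _ (fun x T M => [/\ mad M, M `<=` D x,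
  M `<=` column_decided &
  forall y, olt y x -> M `<=` refinement (Phi (T y)) (T y)])).
- move=> x T T' M TT' [mM MD Mc Mr]; split=> // y yx.
  by rewrite -TT'//; exact: Mr.
- move=> x T IH.
  have [A iA|M [mM ME]] := @mad_exists [set s | [/\ D x s, column_decided s &
      forall y, olt y x -> refinement (Phi (T y)) (T y) s]].
    have [|s [sA iS sr]] := dk x (fun y => refinement (Phi (T y)) (T y)) _ A iA.
      move=> y yx; apply: open_dense_refinement; last exact: PhiI.
      by have [] := IH y yx.
    have [t [ts it [Dt ct]]] :=
      (open_denseI (oD x) open_dense_column_decided).2 s iS.
    exists t; split=> //; first exact: subset_trans sA.
    split=> // y yx; apply: (open_dense_refinement _ _).1 (sr y yx) it _.
    - by have [] := IH y yx.
    - exact: PhiI.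
    - exact: subset_asub.
  by exists M; split=> // [s /ME[]|s /ME[]|y yx s /ME[_ _]] //; exact.
- exact: (inhabits set0).
Qed.

(** * The tree order on a tower *)

Section TowerTree.
Variables (k : ord) (D : k -> set (set nat)).
Variables (Phi : set (set nat) -> set nat -> set nat) (T : k -> set (set nat)).
Hypothesis towT : tower D Phi T.
Implicit Types x y z : k.

Let U : set (set nat) := \bigcup_x T x.

Lemma tower_infinite x s : T x s -> infinite_set s.
Proof. by case: (towT x) => [[iT _ _] _ _ _]; exact: iT. Qed.

Lemma tower_refines x y s : olt y x -> T x s ->
  exists t, [/\ T y t, s `<=*` t & infinite_set (t `\` s)].
Proof.
move=> yx Ts; case: (towT x) => _ _ _ /(_ y yx s Ts)[t [? ? ? _]].
by exists t.
Qed.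

Lemma tower_coarser x y s : ole y x -> T x s -> exists2 t, T y t & s `<=*` t.
Proof.
have [->|yx] := pselect (y = x); first by exists s => //; exact: asub_refl.
move=> yx' Ts; have [|t [Tt st _]] := @tower_refines x y s _ Ts; first by [].
by exists t.
Qed.

Lemma tower_unique x u s t : infinite_set u -> T x s -> T x t ->
  u `<=*` s -> u `<=*` t -> s = t.
Proof.
have [mT _ _ _] := towT x => iu Ts Tt; exact: mad_asub mT Ts Tt iu.
Qed.

(** A member of an earlier level is strictly larger than everything below it, so
    almost inclusion cannot go against the order of levels. *)
Lemma tower_order x y s t : T x s -> T y t -> s `<=*` t -> ole y x.
Proof.
move=> Ts Tt st; apply: contrapT => /(@oltNle k) xy.
have [t' [Tt' tt' it']] := tower_refines xy Tt; apply: it'.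
by rewrite -(tower_unique (tower_infinite Ts) Ts Tt' (asub_refl _) (asub_trans st tt')).
Qed.

Lemma tower_level_unique x y s : T x s -> T y s -> x = y.
Proof.
by move=> Tx Ty; apply: ole_anti; apply: tower_order (asub_refl s).
Qed.

(** The unique member of level [x] above [t] is above [u], hence it is [s]:
    members of the tower with a common lower bound form a chain. *)
Lemma tower_chain x y u s t : infinite_set u -> T x s -> T y t ->
  u `<=*` s -> u `<=*` t -> ole x y -> t `<=*` s.
Proof.
move=> iu Ts Tt us ut xy; have [s' Ts' ts'] := tower_coarser xy Tt.
by rewrite (tower_unique iu Ts Ts' us (asub_trans ut ts')).
Qed.

Lemma tower_pred x t s : T x t ->
  predecessors U t s <-> exists y, [/\ olt y x, T y s & t `<=*` s].
Proof.
move=> Tt; split=> [[[y _ Ts] /asubP ts st]|[y [[yx nyx] Ts ts]]].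
  exists y; split=> //; split; first exact: tower_order Tt Ts ts.
  move=> yx; apply: st; rewrite yx in Ts.
  exact: tower_unique (tower_infinite Tt) Ts Tt ts (asub_refl _).
split; [by exists y|exact/asubP|].
by move=> st; apply: nyx; rewrite st in Ts; exact: tower_level_unique Ts Tt.
Qed.

Lemma tower_le x y t s s' : infinite_set t -> T x s -> T y s' ->
  t `<=*` s -> t `<=*` s' -> tree_le s s' = ole x y.
Proof.
move=> it Ts Ts' ts ts'; apply/idP/idP => [/asubP|xy].
  exact: tower_order Ts' Ts.
by apply/asubP; exact: tower_chain ts ts' xy.
Qed.

(** Exactly one member of each earlier level lies above [t], so the predecessors
    of [t] are indexed by the levels before that of [t]. *)
Lemma tower_predecessors_iso a x t : T x t ->
  order_iso a tree_le (predecessors U t) <-> order_iso a (@ole k) (segment x).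
Proof.
move=> Tt; have it := tower_infinite Tt; split=> ia.
  have /choice[g gP] s : exists y, predecessors U t s ->
      [/\ olt y x, T y s & t `<=*` s].
    have [/(tower_pred _ Tt)[y yP]|n] := pselect (predecessors U t s); first by exists y.
    by exists x.
  apply: (order_iso_trans (f := g) ia).
    split=> [s /gP[]//|s s'|y yx].
      rewrite !inE => /gP[_ Ts ts] /gP[_ Ts' ts'] gE; rewrite gE in Ts.
      exact: tower_unique it Ts Ts' ts ts'.
    have [s [Ts ts _]] := tower_refines yx Tt.
    have ps : predecessors U t s by apply/(tower_pred _ Tt); exists y.
    by exists s => //; have [_ Ts' _] := gP s ps; exact: tower_level_unique Ts' Ts.
  move=> s s' /gP[_ Ts ts] /gP[_ Ts' ts'].
  by rewrite (tower_le it Ts Ts' ts ts').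
have /choice[h hP] y : exists s, olt y x -> T y s /\ t `<=*` s.
  have [yx|n] := pselect (olt y x); last by exists t.
  by have [s [? ? _]] := tower_refines yx Tt; exists s.
apply: (order_iso_trans (f := h) ia).
  split=> [y yx|y z|s /(tower_pred _ Tt)[y [yx Ts ts]]].
  - by apply/(tower_pred _ Tt); exists y; have [] := hP y yx.
  - rewrite !inE => /hP[Ty _] /hP[Tz _] hE; rewrite hE in Ty.
    exact: tower_level_unique Ty Tz.
  - exists y => //; have [Ty ty] := hP y yx.
    exact: tower_unique it Ty Ts ty ts.
move=> y z /hP[Ty ty] /hP[Tz tz]; exact: tower_le ty tz.
Qed.

Lemma tower_is_tree : is_tree U.
Proof.
split=> [s t [x _ Ts] [y _ Tt] /asubP ts /asubP st|t [x _ Tt]].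
  have xy : x = y.
    by apply: ole_anti; [exact: tower_order Tt Ts ts|exact: tower_order Ts Tt st].
  rewrite -xy in Tt.
  exact: tower_unique (tower_infinite Ts) Ts Tt (asub_refl _) st.
have it := tower_infinite Tt.
apply: wochoice.antisymmetric_wo_chain.
  move=> s s'; rewrite !inE => /(tower_pred _ Tt)[y [_ Ty ty]] /(tower_pred _ Tt)[z [_ Tz tz]].
  rewrite (tower_le it Ty Tz)// (tower_le it Tz Ty)// => /andP[yz zy].
  rewrite (ole_anti yz zy) in Ty; exact: tower_unique it Ty Tz ty tz.
move=> A sA [s As].
have pA u : u \in A -> exists y, [/\ olt y x, T y u & t `<=*` u].
  by move=> /sA; rewrite inE => /(tower_pred _ Tt).
have [|m [[u [Au Tu]] mmin]] := @ole_min k (fun y => exists u, u \in A /\ T y u).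
  by have [y [_ Ts _]] := pA s As; exists y, s.
exists u; split=> // v Av; have [y [_ Tv tv]] := pA v Av.
have [z [_ _ tu]] := pA u Au.
by rewrite (tower_le it Tu Tv)//; apply: mmin; exists v.
Qed.

Lemma tower_level a x : order_iso a (@ole k) (segment x) -> level U a = T x.
Proof.
move=> ax; apply/seteqP; split=> [t [[y _ Tt] /(tower_predecessors_iso _ Tt) ay]|t Tt].
  by rewrite (segment_iso_unique ax ay).
by split; [exists x|apply/(tower_predecessors_iso _ Tt)].
Qed.

Lemma tower_level_iso a : level U a !=set0 ->
  exists x, order_iso a (@ole k) (segment x).
Proof.
by move=> [t [[x _ Tt] /(tower_predecessors_iso _ Tt) ax]]; exists x.
Qed.

Lemma tower_height : is_height U k.
Proof.
split=> [|b [y]].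
  rewrite -subset0 => t kt; have [|x [f [[fS fI _] fm]]] := @tower_level_iso k.
    by exists t.
  apply: (olt_leN (fS x I)); apply: (@increasing_expansive k f xpredT) => //.
  move=> u v _ _ [uv nuv]; split; first by rewrite fm.
  by move=> fuv; apply: nuv; apply: fI => //; rewrite inE.
move=> /(@tower_level b y) ->; have [[_ _ mT] _ _ _] := towT y.
by have [t Tt _] := mT _ infinite_nat; exists t.
Qed.

Lemma tower_level_mad a : level U a !=set0 ->
  infinite_set (level U a) /\ mad_family (level U a).
Proof.
move=> /tower_level_iso[x /tower_level->]; have [mT _ cT _] := towT x.
by split; [exact: mad_infinite|exact: mad_mad_family].
Qed.

End TowerTree.

(** * The base tree *)

Lemma open_dense_below (k : ord) (x : k) (D : k -> set (set nat)) : distributive k ->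
  (forall y, open_dense (D y)) ->
  open_dense [set s | forall y, olt y x -> D y s].
Proof.
move=> dk oD; split=> [s t Ds it ts y yx|A iA]; last exact: dk.
exact: (oD y).1 (Ds y yx) it ts.
Qed.

Section BaseTree.
Variables (k : ord) (D : k -> set (set nat)).
Hypothesis distk : distributive k.
Hypothesis oD : forall x, open_dense (D x).
Hypothesis noD : ~ exists s, infinite_set s /\ forall x, D x s.
Implicit Types x y z : k.

(** Otherwise the empty intersection of all [D x] would be the intersection of
    countably many dense families. *)
Lemma countable_bounded (b : nat -> k) : exists x, forall n, ole (b n) x.
Proof.
apply: contrapT => h; apply: noD.
have unb x : exists n, olt x (b n).
  apply: contrapT => n; apply: h; exists x => m; apply: contrapT => bx.
  by apply: n; exists m; exact: oltNle.
have [n|s [_ iS Ds]] := @countable_dense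
    (fun n => [set s | forall y, olt y (b n) -> D y s]) _ _ infinite_nat.
  exact: open_dense_below.
by exists s; split=> // x; have [n xn] := unb x; exact: Ds n x xn.
Qed.

(** A last index would make the intersection of all [D x] dense, as that of
    the earlier ones is dense and the last family is open dense. *)
Lemma no_last x : exists y, olt x y.
Proof.
apply: contrapT => h; apply: noD.
have [s [_ iS [Ds Dx]]] :=
  (open_denseI (open_dense_below x distk oD) (oD x)).2 _ infinite_nat.
exists s; split=> // y; case: (olt_total y x) => [yx|->//|xy].
  exact: Ds.
by exfalso; apply: h; exists y.
Qed.

Variables (Phi : set (set nat) -> set nat -> set nat) (T : k -> set (set nat)).
Hypothesis towT : tower D Phi T.
Hypothesis PhiM : forall M A, wide M A -> M (Phi M A) /\ infinite_set (A `&` Phi M A).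

(** If a single member of each level met [B], then [B] would be almost included
    in all those members and so lie in every [D x]. *)
Lemma tower_splits (B : set nat) : infinite_set B ->
  exists x (t : bool -> set nat), [/\ forall b, T x (t b), t true <> t false &
    forall b, infinite_set (B `&` t b)].
Proof.
move=> iB; apply: contrapT => h; apply: noD; exists B; split=> // x.
have [[_ _ mT] TD _ _] := towT x.
have [t Tt iBt] := mT B iB.
suff Bt : B `<=*` t by apply: (oD x).1 (TD t Tt) iB Bt.
apply: contrapT => iBmt; apply: h.
have [t' Tt' it'] := mT _ iBmt.
exists x, (fun b => if b then t else t'); split=> [[]//||[]//].
  by move=> tt'; rewrite -tt' in it'; have /infinite_setN0[y [[]]] := it'.
by apply: sub_infinite_set it' => y [[]].
Qed.

(** Splitting [A] repeatedly gives a binary tree of infinite traces. The countably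
    many levels used lie below one level [y]; each of the continuum many branches
    has a pseudo-intersection that meets some member of level [y], and two branches
    cannot meet the same member, since that member refines only one side of the
    split where they part. *)
Lemma tower_wide (A : set nat) : infinite_set A -> exists x, wide (T x) A.
Proof.
move=> iA; have [x0 _] := tower_splits iA.
have /choice[F FP] (B : set nat) : exists xt : k * (bool -> set nat), infinite_set B ->
  [/\ forall b, T xt.1 (xt.2 b), xt.2 true <> xt.2 false &
    forall b, infinite_set (B `&` xt.2 b)].
  have [iB|n] := pselect (infinite_set B); last by exists (x0, fun=> set0).
  by have [x [t h]] := tower_splits iB; exists (x, t).
pose node := fix node (l : seq bool) : set nat :=
  if l is b :: l' then node l' `&` (F (node l')).2 b else A.
have iN l : infinite_set (node l).
  by elim: l => [//|b l IH] /=; have [_ _] := FP _ IH; exact.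
have [y yP] := countable_bounded (fun n => (F (node (odflt [::] (unpickle n)))).1).
have levy l : ole (F (node l)).1 y by have := yP (pickle l); rewrite pickleK.
pose branch := fix branch (C : set nat) n : seq bool :=
  if n is m.+1 then `[< C m >] :: branch C m else [::].
have /choice[P PP] (C : set nat) :
    exists s, infinite_set s /\ forall n, s `<=*` node (branch C n).
  have [n|n /=|s iS sP] := @pseudo_intersection (fun n => node (branch C n)).
  - exact: iN.
  - by move=> z [].
  - by exists s.
have /choice[t tP] C : exists t, T y t /\ infinite_set (P C `&` t).
  have [[_ _ mT] _ _ _] := towT y.
  by have [t Tt it] := mT _ (PP C).1; exists t.
exists y, t; last first.
  move=> C; have [Tt it] := tP C; split=> //.
  exact: meet_asub it ((PP C).2 0) (asub_refl _).
move=> C C' tCC'.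
(* The member of the splitting level above [t B] is the side chosen by bit n of B. *)
have bitP (B : set nat) n t' : t B `<=*` t' -> T (F (node (branch B n))).1 t' ->
    t' = (F (node (branch B n))).2 `[< B n >].
  move=> tt' Tt'; have [Ft _ _] := FP _ (iN (branch B n)).
  have [[_ aT _] _ _ _] := towT (F (node (branch B n))).1.
  apply: aT => //; rewrite setIC.
  apply: meet_asub (tP B).2 _ tt'; apply: asub_trans ((PP B).2 n.+1) _.
  by apply: subset_asub => z [].
have bits n : branch C n = branch C' n -> `[< C n >] = `[< C' n >].
  move=> e; have [t' Tt' tt'] := tower_coarser towT (levy (branch C n)) (tP C).1.
  have := bitP C n t' tt' Tt'; rewrite tCC' in tt'; rewrite e in Tt' *.
  rewrite (bitP C' n t' tt' Tt'); have [_ d _] := FP _ (iN (branch C' n)).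
  by case: `[< C n >]; case: `[< C' n >] => // h; case: d; rewrite h.
have branchE n : branch C n = branch C' n.
  by elim: n => //= n IH; rewrite IH (bits n IH).
apply/funext => n; apply/propext; have Cn := bits n (branchE n).
by split=> h; apply/asboolP; [rewrite -Cn|rewrite Cn]; apply/asboolP.
Qed.

Lemma tower_tree_pi_base : tree_pi_base (\bigcup_x T x).
Proof.
split.
- by move=> t [x _ Tt]; exact: tower_infinite towT _ _ Tt.
- exact: tower_is_tree towT.
- exact: tower_level_mad towT.
move=> A iA; have [x wA] := tower_wide iA; have [Tt iAt] := PhiM wA.
(* The member reserved for A is decided on a later level, and a part of it on
   that level with infinite trace on A falls inside A. *)
have [y xy] := no_last x; have [[_ _ mT] _ _ /(_ x xy) rT] := towT y.
have [s Ts its] := mT _ iAt; exists s; first by exists y.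
apply/asubP; have [t [Tt' st _ tA]] := rT s Ts.
have tE : t = Phi (T x) A.
  have [[_ aT _] _ _ _] := towT x; apply: aT => //.
  rewrite setIC; apply: (meet_asub its) st; by apply: subset_asub => z [].
case: (tA A wA tE) => // fsA; case: its.
by apply: sub_finite_set fsA => z [[]].
Qed.

End BaseTree.

(** The theorem of Balcar, Pelant and Simon, for an arbitrary distributive index
    order: the levels can be taken inside prescribed open dense families whose
    intersection is empty. *)
Theorem base_tree (c k : ord) (D : k -> set (set nat)) :
  initial_continuum c -> distributive k -> (forall x, open_dense (D x)) ->
  (~ exists s, infinite_set s /\ forall x, D x s) ->
  exists U, [/\ tree_pi_base U, is_height U k &
    forall a x, order_iso a (@ole k) (segment x) -> level U a `<=` D x].
Proof.
move=> cc dk oD noD.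
have /choice[Phi PhiP] M := wide_representatives M cc.
have [|T towT] := @tower_exists k D Phi dk oD; first by move=> M; exact: (PhiP M).2.
exists (\bigcup_x T x); split.
- by apply: (tower_tree_pi_base dk oD noD towT) => M; exact: (PhiP M).1.
- exact: tower_height towT.
- move=> a x ax; rewrite (tower_level towT ax); by have [] := towT x.
Qed.

(** * Distributivity of the continuum *)

Lemma open_dense_image (e : nat -> nat) (D : set (set nat)) :
  injective e -> open_dense D -> open_dense [set s | D (e @` s)].
Proof.
move=> eI [Do Dd]; split=> [s t Ds it ts|A iA].
  apply: (Do _ _ Ds); first exact: infinite_image.
  apply: (@sub_finite_set _ _ (e @` (t `\` s))); last exact: finite_image.
  by move=> _ [[m tm <-] nsm]; exists m => //; split=> // sm; apply: nsm; exists m.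
have [s [sA iS Ds]] := Dd _ (infinite_image eI iA).
have es : e @` (e @^-1` s) = s.
  apply/seteqP; split=> [_ [m sm <-]//|m sm]; have [n _ nm] := sA m sm.
  by exists n; rewrite /preimage/= nm.
exists (e @^-1` s); split=> [m /= /sA[n An /eI<-]//||] /=; last by rewrite es.
by move=> h; apply: iS; rewrite -es; exact: finite_image.
Qed.

(** At the least index where distributivity fails, some open dense families have
    no common member below a set [A]. Transported from [A] to [nat] by an
    injection they have no common member at all, and the base tree on them is a
    tree pi-base of height less than the continuum, which the principle forbids. *)
Lemma continuum_distributive c :
  principle_star -> initial_continuum c -> distributive c.
Proof.
move=> star cc x D oD A iA; apply: contrapT => nA.
pose bad x := exists D : c -> set (set nat),
  (forall y, olt y x -> open_dense (D y)) /\
  exists2 A, infinite_set A & ~ exists s, [/\ s `<=` A, infinite_set s &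
     forall y, olt y x -> D y s].
have [|m [[{}D [{}oD [{}A {}iA {}nA]]] mmin]] := @ole_min c bad.
  by exists x, D; split=> //; exists A.
have segE (u v : segment_ord m) : olt u v <-> olt (sval u) (sval v).
  split=> -[uv nuv]; split=> //.
    by move=> h; apply: nuv; exact: segment_val_inj h.
  by move=> h; apply: nuv; rewrite h.
have dk : distributive (segment_ord m).
  move=> [z zm] E oE B iB; apply: contrapT => nB; apply: (olt_leN zm).
  (* Only the indices below z < m matter for the minimality of m, so E may be
     extended arbitrarily beyond m. *)
  pose ext y := if pselect (olt y m) is left h then E (exist _ y h) else setT.
  have extE y (ym : olt y m) : ext y = E (exist _ y ym).
    by rewrite /ext; case: pselect => // h; rewrite (Prop_irrelevance h ym).
  apply: mmin; exists ext; split=> [y yz|].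
    have ym := olt_trans yz zm; rewrite (extE _ ym); apply: oE.
    exact/segE.
  exists B => // -[s [sB iS Es]]; apply: nB; exists s; split=> // -[y ym] /segE yz.
  by rewrite -extE; exact: Es.
have [e eI eA] := (infinite_embeds A).1 iA.
have [u|[s [iS Ds]]|U [pU hU _]] := @base_tree c (segment_ord m)
    (fun u => [set s | D (sval u) (e @` s)]) cc dk.
- by apply: open_dense_image => //; apply: oD; exact: svalP u.
- apply: nA; exists (e @` s); split; first by move=> _ [n _ <-].
    exact: infinite_image.
  by move=> y ym; exact: (Ds (exist _ y ym)).
- have [noU _] := star c (initial_continuum_is_continuum cc).
  by apply: (noU U _ pU hU); exact: segment_ord_lt.
Qed.

(** * From a branch to an ultrafilter *)

(** Tasks are handed out to the indices by an injective coding, so each index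
    carries at most one of them and the family is open dense there. *)
Lemma open_dense_at (I K : Type) (e : I -> K) (E : I -> set (set nat)) (x : K) :
  injective e -> (forall i, open_dense (E i)) ->
  open_dense [set s | forall i, e i = x -> E i s].
Proof.
move=> eI oE; split=> [s t Es it ts i ix|A iA].
  exact: (oE i).1 (Es i ix) it ts.
have [[i ix]|n] := pselect (exists i, e i = x).
  have [s [sA iS Es]] := (oE i).2 A iA; exists s; split=> // j jx.
  by rewrite (_ : j = i) //; apply: eI; rewrite jx.
by exists A; split=> // i ix; case: n; exists i.
Qed.

Lemma open_dense_decided (B : set nat) :
  open_dense [set s | s `<=*` B \/ finite_set (s `&` B)].
Proof.
split=> [s t [sB|sB] it ts|A iA].
- by left; exact: asub_trans sB.
- by right; exact: finite_meet_asub sB.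
have [iAB|fAB] := pselect (infinite_set (A `&` B)).
  by exists (A `&` B); split=> //; left; apply: subset_asub => x [].
by exists A; split=> //; right; exact: contrapT.
Qed.

Lemma nothing_decides_all (s : set nat) : infinite_set s ->
  ~ forall B, s `<=*` B \/ finite_set (s `&` B).
Proof.
move=> iS sB; have [B [Bs iB isB]] := infinite_halve iS.
by case: (sB B) => // h; apply: iB; rewrite -(setIidr Bs).
Qed.

(** Convergence of [u] along the filter of cofinite subsets of [s]. *)
Definition converges_along (X : topologicalType) (u : nat -> X) (s : set nat) :=
  exists x : X, forall V, nbhs x V -> s `<=*` (u @^-1` V).

Lemma open_dense_converges (X : topologicalType) (u : nat -> X) :
  sequentially_compact X -> open_dense (converges_along u).
Proof.
move=> Xseq; split=> [s t [x sx] it ts|A /infinite_embeds[f fI Af]].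
  by exists x => V /sx; exact: asub_trans.
have [k [kI [x kx]]] := Xseq (u \o f).
have kinj : injective k.
  move=> m n kmn; case: (ltngtP m n) => // /kI; by rewrite kmn ltnn.
exists (range (f \o k)); split=> [_ [n _ <-]||]; first exact: Af.
  apply/infinite_embeds; exists (f \o k); first exact: inj_comp.
  by move=> n; exists n.
exists x => V /kx[N _ NV].
apply: (@sub_finite_set _ _ ((f \o k) @` `I_N)); last exact: finite_image.
move=> _ [[n _ <-] nV]; exists n => //=; rewrite ltnNge; apply/negP => Nn.
by apply: nV; exact: NV.
Qed.

Lemma sequences_embed (X : Type) : [set: X] #<= [set: set nat] ->
  exists f : (nat -> X) -> set nat, injective f.
Proof.
move=> /card_leT_embeds[i iI _].
exists (fun u => [set pickle nm | nm in [set nm : nat * nat | i (u nm.1) nm.2]]).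
move=> u v uv; apply/funext => n; apply: iI; apply/seteqP.
have mem (w : nat -> X) m : i (w n) m <->
    [set pickle nm | nm in [set nm : nat * nat | i (w nm.1) nm.2]] (pickle (n, m)).
  by split=> [h|[nm h /(pcan_inj pickleK) E]]; [exists (n, m)|move: h; rewrite E].
by split=> m /mem; [rewrite uv|rewrite -uv] => /mem.
Qed.

Theorem theorem2p2 (star : principle_star) (X : topologicalType)
    (Xseq : sequentially_compact X) (Xcard : [set: X] #<= [set: set nat]) :
  exists p : set_system nat, nonprincipal_ultrafilters p /\ p_compact p X.
Proof.
have [c cc] := initial_continuum_exists.
have [[e eI _] _ _] := cc.
have [g gI] := sequences_embed Xcard.
pose D x : set (set nat) :=
  [set s | forall B, e B = x -> s `<=*` B \/ finite_set (s `&` B)] `&`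
  [set s | forall u, e (g u) = x -> converges_along u s].
have oD x : open_dense (D x).
  apply: open_denseI.
    by apply: (@open_dense_at _ _ e) => // B; exact: open_dense_decided.
  apply: (@open_dense_at _ _ (e \o g)); first exact: inj_comp.
  by move=> u; exact: open_dense_converges.
have [[s [iS Ds]]|U [pU hU levU]] :=
    @base_tree c c D cc (continuum_distributive star cc) oD.
  by apply: (nothing_decides_all iS) => B; apply: (Ds (e B)).1.
have [_ /(_ U pU hU)[B [[BU Bchain] _ Bcof]]] :=
  star c (initial_continuum_is_continuum cc).
have BD x : exists2 t, B t & D x t.
  have [t [Bt /levU Dt]] := Bcof c _ hU (segment_ord_lt x).
  by exists t => //; apply: Dt; exact: segment_ord_iso.
have iB t : B t -> infinite_set t by move=> /BU; case: pU => iU _ _ _; exact: iU.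
pose F : set_system nat := [set S | exists2 t, B t & t `<=*` S].
have FF : ProperFilter F.
  split; first by move=> [t /iB it]; rewrite setD0.
  split.
  - have [t Bt _] := BD (e set0); exists t => //.
    by apply: subset_asub.
  - move=> S S' [t Bt tS] [t' Bt' tS'].
    (* The branch is a chain, so one of the two witnesses lies below the other. *)
    wlog tt' : S S' t t' Bt Bt' tS tS' / t `<=*` t'.
      move=> wl; case: (Bchain _ _ Bt Bt') => /asubP h.
        by rewrite setIC; exact: wl h.
      exact: wl h.
    exists t => //; rewrite setDIr finite_setU; split=> //.
    exact: asub_trans tS'.
  - by move=> S S' SS' [t Bt tS]; exists t => //; apply: asub_trans tS (subset_asub _).
have [p [up Fp]] := ultraFilterLemma FF.
exists p; split; first split=> // -[n pn].
  (* Cofinite sets belong to F, since almost inclusion ignores finite sets. *)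
  have : p (~` [set n]).
    apply: Fp; have [t Bt _] := BD (e set0); exists t => //.
    by rewrite setDE setCK; exact: finite_setIr.
  by rewrite pn => /principal_filterP; apply.
move=> u; have [t Bt [_ /(_ u erefl)[x tx]]] := BD (e (g u)).
by exists x => V /tx tV; apply: Fp; exists t.
Qed.
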